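(* Let $f\in\mathbb{Q}^2$ and $r^1,\dots,r^k\in\mathbb{Q}^2$, and let $R_f=\{\,s\in\mathbb{R}^k_+ : f+\sum_{j=1}^k r^j s_j\in\mathbb{Z}^2\,\}$. Then the number of facets of the mixed integer hull $\operatorname{conv}(R_f)$ is bounded by a polynomial in the binary encoding sizes of $f,r^1,\dots,r^k$ (i.e. there is a fixed polynomial $q$, independent of the data, such that the number of facets is at most $q$ evaluated at the total binary encoding size of $f,r^1,\dots,r^k$).
   Context: $\mathbb{R}^k_+$ denotes the nonnegative orthant of $\mathbb{R}^k$; $\operatorname{conv}$ denotes convex hull. For rational data $\operatorname{conv}(R_f)$ is a polyhedron. *)

(* Defs.v *)
From HB Require Import structures.
From mathcomp Require Import all_boot all_order all_algebra.
From mathcomp Require Import all_classical all_reals all_analysis.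

Set Implicit Arguments.
Unset Strict Implicit.
Unset Printing Implicit Defensive.

Import Order.TTheory GRing.Theory Num.Theory.

Local Open Scope classical_set_scope.
Local Open Scope ring_scope.

(* Schrijver's encoding sizes: 1 + ceil(log2(|p| + 1)) + ceil(log2(q + 1)) for
   a rational p/q in lowest terms with q > 0, and n plus the sizes of the
   entries for a vector with n entries.  [up_log 2 m] is ceil(log2 m). *)
Definition rat_size (x : rat) : nat :=
  (1 + up_log 2 (`|numq x| + 1) + up_log 2 (`|denq x| + 1))%N.

Definition rV_size (n : nat) (x : 'rV[rat]_n) : nat :=
  (n + \sum_(i < n) rat_size (x 0%R i))%N.

Definition data_size (k : nat) (f : 'rV[rat]_2) (r : 'I_k -> 'rV[rat]_2) :
  nat := (rV_size f + \sum_(j < k) rV_size (r j))%N.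

Section Hull.
Variable R : realType.

Definition mixed_integer_set (k : nat) (f : 'rV[rat]_2)
    (r : 'I_k -> 'rV[rat]_2) : set 'rV[R]_k :=
  [set s | (forall j, 0 <= s 0 j) /\
    map_mx ratr f + \sum_(j < k) s 0 j *: map_mx ratr (r j)
      \is a mxOver (Num.int : {pred R})].

Definition convex_hull (k : nat) (A : set 'rV[R]_k) : set 'rV[R]_k :=
  smallest (@convex_set R 'rV[R]_k) A.

(* The empty set has no dimension in this sense, so a facet is nonempty. *)
Definition has_affine_dim (k : nat) (A : set 'rV[R]_k) (d : nat) : Prop :=
  exists (x0 : 'rV[R]_k) (v : d.-tuple 'rV[R]_k),
    [/\ A x0, forall i, A (x0 + tnth v i), free v &
        forall x, A x -> x - x0 \in <<v>>%VS].

Definition is_face (k : nat) (P F : set 'rV[R]_k) : Prop :=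
  exists (a : 'cV[R]_k) (b : R),
    (forall x, P x -> (x *m a) 0 0 <= b) /\
    F = P `&` [set x | (x *m a) 0 0 = b].

Definition is_facet (k : nat) (P F : set 'rV[R]_k) : Prop :=
  is_face P F /\ exists d, has_affine_dim F d /\ has_affine_dim P d.+1.

Definition facets (k : nat) (P : set 'rV[R]_k) : set (set 'rV[R]_k) :=
  [set F | is_facet P F].

End Hull.

Arguments mixed_integer_set R [k] f r.

(* Main.v *)
Require Import Defs.
From mathcomp Require Import all_boot all_order all_algebra.
From mathcomp Require Import all_classical all_reals all_analysis.
From mathcomp Require Import zify ring lra.

(* Apart from the coordinate hyperplanes [x_j = 0], the facets of [conv R_f]
   are cut out by [gamma . x = 1] with [gamma >= 0], where [gamma] is the only
   solution of the equations [gamma . s = 1] over the tight points [s] of [R_f].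
   Since [s] may be rewritten along any nonnegative relation among the rays,
   [gamma] is subadditive; if [S] is a minimal set of rays generating all the
   others together with their [gamma] values, then [gamma] is determined by its
   values on [S], and these by the tight points supported on [S].

   [S] has at most 36 elements: each ray of [S] lies in the support of a tight
   point supported on [S], and if three rays of [S] in a common half plane had
   tight points whose lattice points agree modulo 3, then the average of these
   points would be tight as well, so that every linear relation among the three
   rays would also hold for [gamma], and one of them could be dropped from [S].

   Tight points on [S] reduce to tight points on at most two independent rays,
   and of those only the lexicographically smallest one for each order of the
   rays matters.  Such a point is not the midpoint of two other points of [R_f]
   on the same rays, so two of them, even for different [gamma], never lie in a
   common dyadic box (otherwise reflect one in the other); the number of boxes
   is polynomial in the encoding size. *)

Set Implicit Arguments.
Unset Strict Implicit.
Unset Printing Implicit Defensive.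

Import Order.TTheory GRing.Theory Num.Theory.
Local Open Scope ring_scope.

Lemma ord2_cases (i : 'I_2) : i = 0 \/ i = 1.
Proof. by case: i => -[|[|//]] i; [left|right]; apply/val_inj. Qed.

Lemma sum_ord2 (V : nmodType) (F : 'I_2 -> V) : \sum_i F i = F 0 + F 1.
Proof.
by rewrite !big_ord_recl big_ord0 addr0; congr (_ + F _); apply/val_inj.
Qed.

(** If [b > 0] and [m] is the common logarithm, then [a.+1 <= 2^m] and [2^(m-1) <= b]. This compares
    the coordinates of two points of one dyadic box. *)
Lemma same_bits_le_double (a b : nat) :
  up_log 2 a.+1 = up_log 2 b.+1 -> (a <= b.*2)%N.
Proof.
case: b => [|b] ab.
  by have := up_logP a.+1 (isT : 1 < 2)%N; rewrite ab/=.
have := up_logP a.+1 (isT : 1 < 2)%N; rewrite ab.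
have := @up_log_gtn 2 b.+2 isT isT.
have : (0 < up_log 2 b.+2)%N by rewrite up_log_gt0.
by case: (up_log 2 b.+2) => // m _ /=; rewrite expnS; lia.
Qed.

(** * Tight points and generating sets of rays *)

Section FacetNormals.
Variables (R : archiRealFieldType) (k : nat).
Variables (f : 'rV[R]_2) (M : 'M[R]_(k, 2)).
Implicit Types (s c d e : 'rV[R]_k) (g h : 'cV[R]_k) (S : {set 'I_k}).

Definition dot s g : R := (s *m g) 0 0.

Definition feasible s : Prop :=
  (forall j, 0 <= s 0 j) /\ f + s *m M \is a mxOver (Num.int : {pred R}).

Definition tight g s : Prop := feasible s /\ dot s g = 1.

(** The last clause says that the tight points span the space, so that they determine [g]. *)
Definition facet_normal g : Prop :=
  [/\ forall s, feasible s -> 1 <= dot s g,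
      forall j, 0 <= g j 0 &
      forall h, (forall s, tight g s -> dot s h = 0) -> h = 0].

(** Row [i] of [C] writes ray [i], together with its value under [g], in terms of the rays of [S];
    hence [s *m C] is tight and supported on [S] whenever [s] is tight. *)
Definition generates g S : Prop :=
  exists C : 'M[R]_k, [/\ forall i j, 0 <= C i j, C *m M = M, C *m g = g &
    forall i j, j \notin S -> C i j = 0].

Definition minimal_gen g S : Prop :=
  generates g S /\ forall j, j \in S -> ~ generates g (S :\ j).

Definition supported s S : Prop := forall j, j \notin S -> s 0 j = 0.

Lemma dotE s g : dot s g = \sum_j s 0 j * g j 0.
Proof. by rewrite /dot mxE. Qed.

Lemma dotDl s c g : dot (s + c) g = dot s g + dot c g.
Proof. by rewrite /dot mulmxDl mxE. Qed.

Lemma dotNl s g : dot (- s) g = - dot s g.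
Proof. by rewrite /dot mulNmx mxE. Qed.

Lemma dotZl a s g : dot (a *: s) g = a * dot s g.
Proof. by rewrite /dot -scalemxAl mxE. Qed.

Lemma dotDr s g h : dot s (g + h) = dot s g + dot s h.
Proof. by rewrite /dot mulmxDr mxE. Qed.

Lemma dotNr s g : dot s (- g) = - dot s g.
Proof. by rewrite /dot mulmxN mxE. Qed.

Lemma dot0l g : dot 0 g = 0.
Proof. by rewrite /dot mul0mx mxE. Qed.

Lemma dot_mulmx s (C : 'M[R]_k) g : dot (s *m C) g = dot s (C *m g).
Proof. by rewrite /dot mulmxA. Qed.

Lemma dot_delta_l j g : dot (delta_mx 0 j) g = g j 0.
Proof. by rewrite /dot -rowE mxE. Qed.

Lemma dot_delta_r j s : dot s (delta_mx j 0) = s 0 j.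
Proof. by rewrite /dot -colE mxE. Qed.

Lemma row_dot i (C : 'M[R]_k) g : dot (row i C) g = (C *m g) i 0.
Proof. by rewrite /dot -row_mul mxE. Qed.

Lemma feasible_mulmx s (C : 'M[R]_k) :
  (forall i j, 0 <= C i j) -> C *m M = M -> feasible s -> feasible (s *m C).
Proof.
move=> C0 CM [s0 sM]; split; last by rewrite -mulmxA CM.
by move=> j; rewrite mxE sumr_ge0// => i _; rewrite mulr_ge0.
Qed.

(** If [c] had a smaller value than ray [i], trading the ray for [c] in a tight point that uses it
    would violate validity. So every tight point would vanish at [i], and the tight points could not
    span. *)
Lemma facet_normal_subadditive g c i : facet_normal g ->
  (forall j, 0 <= c 0 j) -> c *m M = row i M -> g i 0 <= dot c g.
Proof.
move=> [valid _ uniq] c0 cM; rewrite leNgt; apply/negP => lt_cg.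
suff /(congr1 (fun h : 'cV[R]_k => h i 0)) : delta_mx i 0 = 0 :> 'cV[R]_k.
  by move/eqP; rewrite !mxE !eqxx oner_eq0.
apply: uniq => s [[s0 sM] sg]; rewrite dot_delta_r.
set t := s + s 0 i *: (c - delta_mx 0 i).
have t_feas : feasible t.
  split; last first.
    by rewrite mulmxDl -scalemxAl mulmxBl -rowE cM subrr scaler0 addr0.
  move=> j; rewrite !mxE eqxx/=; have := s0 j; have := s0 i; have := c0 j.
  by have [->|_] := eqVneq j i => /=; nra.
have := valid _ t_feas.
rewrite dotDl dotZl dotDl dotNl dot_delta_l sg.
by have := s0 i; nra.
Qed.

Lemma generates_setT g : generates g [set: 'I_k].
Proof.
exists 1%:M; split; rewrite ?mul1mx// => i j; last by rewrite inE.
by rewrite mxE; case: eqP.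
Qed.

Lemma minimal_gen_exists g : exists S, minimal_gen g S.
Proof.
have : exists S, [pred S : {set 'I_k} | `[< generates g S >]] S.
  by exists [set: 'I_k]; apply/asboolP; exact: generates_setT.
move=> /ex_minset[S /minsetP[/asboolP gS minS]]; exists S; split=> // j jS gj.
have /setP/(_ j) := minS _ (asboolT gj) (subD1set _ _).
by rewrite !inE eqxx jS.
Qed.

Lemma generates_remove g S c j : generates g S -> (forall l, 0 <= c 0 l) ->
  supported c (S :\ j) -> c *m M = row j M -> dot c g = g j 0 ->
  generates g (S :\ j).
Proof.
move=> [C [C0 CM Cg CS]] c0 cS cM cg.
(* Every use of ray [j] is replaced by the combination [c]. *)
exists (C + col j C *m (c - delta_mx 0 j)); split.
- move=> i l; rewrite !mxE big_ord1 !mxE eqxx/=.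
  have := C0 i l; have := C0 i j; have := c0 l.
  have [->|_] := eqVneq l j => /=; last by nra.
  by rewrite (cS j) ?inE ?eqxx//; lra.
- by rewrite mulmxDl -mulmxA mulmxBl -rowE cM subrr mulmx0 CM addr0.
- rewrite mulmxDl -mulmxA mulmxBl -rowE Cg.
  suff -> : c *m g = row j g by rewrite subrr mulmx0 addr0.
  by apply/matrixP => a b; rewrite !ord1 -[LHS]/(dot c g) cg mxE.
- move=> i l; rewrite 2!inE negb_and negbK => lS.
  rewrite !mxE big_ord1 !mxE eqxx/=.
  have [->|lj] := eqVneq l j => /=.
    by rewrite (cS j) ?inE ?eqxx//; ring.
  rewrite (negPf lj)/= in lS.
  by rewrite CS// cS ?inE ?(negPf lS) ?andbF//; ring.
Qed.

(** The ratio test: [t] is the least quotient [s 0 l / d 0 l], so that a coordinate of [s - t *: d]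
    drops to zero. *)
Lemma maximal_step s d l0 : (forall l, d 0 l != 0 -> 0 < s 0 l) ->
  (forall l, 0 <= s 0 l) -> (forall l, 0 <= d 0 l) -> d 0 l0 != 0 ->
  exists2 t, 0 < t & (forall l, t * d 0 l <= s 0 l) /\
    exists2 l, d 0 l != 0 & s 0 l = t * d 0 l.
Proof.
move=> ds s0 d0 dl0.
have [l dl lmin] := @arg_minP _ _ _ l0 (fun l => d 0 l != 0)
  (fun l => s 0 l / d 0 l) dl0.
have dgt0 i : d 0 i != 0 -> 0 < d 0 i by rewrite lt_def d0 andbT.
exists (s 0 l / d 0 l); first by rewrite divr_gt0 ?ds ?dgt0.
split; last by exists l => //; rewrite divfK.
move=> i; have [d0i|di] := eqVneq (d 0 i) 0. by rewrite d0i mulr0.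
by rewrite -ler_pdivlMr ?dgt0// lmin.
Qed.

(* A tight point can be moved slightly both ways along a linear relation
   supported on its support, without leaving the feasible set. *)
Lemma relation_dot_eq0 g s d : facet_normal g -> tight g s -> d *m M = 0 ->
  (forall l, d 0 l != 0 -> 0 < s 0 l) -> dot d g = 0.
Proof.
move=> [valid _ _] [[s0 sM] sg] dM ds.
have [/eqP-> |/rV0Pn[l0 dl0]] := boolP (d == 0); first by rewrite dot0l.
(* With absolute values, both steps [t] and [- t] along [d] are admissible. *)
have [||||t t0 [tle _]] := @maximal_step s (map_mx Num.norm d) l0.
- by move=> l; rewrite mxE normr_eq0; exact: ds.
- exact: s0.
- by move=> l; rewrite mxE.
- by rewrite mxE normr_eq0.
have ineq (u : R) : `|u| = t -> 0 <= u * dot d g.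
  move=> ut; have : feasible (s + u *: d).
    split; last by rewrite mulmxDl -scalemxAl dM scaler0 addr0.
    move=> j; rewrite !mxE; have := tle j; rewrite mxE -ut -normrM.
    by have := ler_norm (- (u * d 0 j)); rewrite normrN; lra.
  by move/valid; rewrite dotDl dotZl sg; lra.
have := ineq t (gtr0_norm t0); have := ineq (- t).
rewrite normrN gtr0_norm// => /(_ erefl).
by nra.
Qed.

(** Solving the relation for ray [j] writes it as a nonnegative combination of the other rays of [S]
    with the same value, against minimality. *)
Lemma no_one_positive_relation g S d j : minimal_gen g S -> supported d S ->
  d *m M = 0 -> dot d g = 0 -> 0 < d 0 j ->
  (forall l, l != j -> d 0 l <= 0) -> False.
Proof.
move=> [gS minS] dS dM dg dj dl.
have jS : j \in S.
  by apply/negPn/negP => /dS dj0; rewrite dj0 ltxx in dj.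
apply: (minS j jS).
apply: (@generates_remove g S (delta_mx 0 j - (d 0 j)^-1 *: d)) => //.
- move=> l; rewrite !mxE eqxx/=; have [->|lj] := eqVneq l j => /=.
    by rewrite mulVf ?gt_eqF// subrr.
  by rewrite sub0r -mulrN mulr_ge0 ?invr_ge0 ?(ltW dj)// oppr_ge0 dl.
- move=> l; rewrite !inE negb_and negbK => lS; rewrite !mxE eqxx/=.
  have [->|lj] := eqVneq l j => /=; first by rewrite mulVf ?gt_eqF// subrr.
  by rewrite (negPf lj)/= in lS; rewrite (dS l)// mulr0 subrr.
- by rewrite mulmxBl -scalemxAl dM scaler0 subr0 -rowE.
- by rewrite dotDl dotNl dotZl dg mulr0 subr0 dot_delta_l.
Qed.

(** By [no_one_positive_relation] for [d] and [- d], a relation with both signs has two positive and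
    two negative coefficients, too many for [w]. *)
Lemma short_relation_one_signed g S d (w : seq 'I_k) : minimal_gen g S ->
  supported d S -> d *m M = 0 -> dot d g = 0 -> (size w <= 3)%N ->
  (forall l, d 0 l != 0 -> l \in w) ->
  (forall l, 0 <= d 0 l) \/ (forall l, d 0 l <= 0).
Proof.
move=> mS dS dM dg w3 dw; apply: contrapT => /not_orP[].
move=> /existsNP[n /negP]; rewrite -ltNge => dn.
move=> /existsNP[p /negP]; rewrite -ltNge => dp.
have [onep|] := pselect (forall l, l != p -> d 0 l <= 0).
  exact: (@no_one_positive_relation g S d p).
move=> /existsNP[q /not_implyP[qp /negP]]; rewrite -ltNge => dq.
have [onen|] := pselect (forall l, l != n -> 0 <= d 0 l).
  apply: (@no_one_positive_relation g S (- d) n) => //.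
  - by move=> l /dS; rewrite mxE => ->; rewrite oppr0.
  - by rewrite mulNmx dM oppr0.
  - by rewrite dotNl dg oppr0.
  - by rewrite mxE oppr_gt0.
  - by move=> l /onen; rewrite mxE oppr_le0.
move=> /existsNP[m /not_implyP[mn /negP]]; rewrite -ltNge => dm.
have neq i l : d 0 i < 0 -> 0 < d 0 l -> i != l.
  by move=> di dl; apply/negP => /eqP il; move: di; rewrite il ltNge ltW.
have : uniq [:: n; m; p; q].
  by rewrite /= !inE !negb_or (eq_sym n m) (eq_sym p q) mn qp !neq.
move=> /uniq_leq_size uls.
have sub : {subset [:: n; m; p; q] <= w}.
  by move=> i; rewrite !inE => /or4P[]/eqP->; apply: dw;
    rewrite ?(lt_eqF dn) ?(lt_eqF dm) ?(gt_eqF dp) ?(gt_eqF dq).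
by have /= := leq_trans (uls _ sub) w3.
Qed.

Definition rays (w : seq 'I_k) : 'M[R]_(size w, 2) :=
  rowsub (tnth (in_tuple w)) M.

Lemma rays_relation (w : seq 'I_k) : uniq w -> ~~ row_free (rays w) ->
  exists d, [/\ d != 0, d *m M = 0 & forall l, d 0 l != 0 -> l \in w].
Proof.
move=> uw; rewrite -kermx_eq0 => ker0.
set u := nz_row (kermx (rays w)).
have u0 : u != 0 by rewrite nz_row_eq0.
have /sub_kermxP uB : (u <= kermx (rays w))%MS by exact: nz_row_sub.
have xinj : injective (tnth (in_tuple w)) by exact/tuple_uniqP.
exists (u *m rowsub (tnth (in_tuple w)) 1%:M); split.
- have /rV0Pn[a ua] := u0; apply/rV0Pn; exists (tnth (in_tuple w) a).
  rewrite mxE (bigD1 a)//= big1 => [|b ba].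
    by rewrite !mxE eqxx mulr1 addr0.
  by rewrite !mxE (inj_eq xinj) (negPf ba) mulr0.
- by rewrite -mulmxA mul_rowsub_mx mul1mx.
- move=> l; rewrite mxE; apply: contraR => lw; apply/eqP; rewrite big1// => a _.
  rewrite !mxE; case: eqP => [al|_]; last by rewrite mulr0.
  by move: lw; rewrite -al mem_tnth.
Qed.

Lemma rays_not_free (w : seq 'I_k) : (2 < size w)%N -> ~~ row_free (rays w).
Proof.
move=> w3; apply/negP; rewrite /row_free => /eqP rw.
by have := rank_leq_col (rays w); rewrite rw leqNgt w3.
Qed.

Lemma one_signed_relation g S s (w : seq 'I_k) : facet_normal g ->
  minimal_gen g S -> tight g s -> supported s S -> (size w <= 3)%N ->
  uniq w -> {in w, forall l, 0 < s 0 l} -> ~~ row_free (rays w) ->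
  exists d, [/\ d != 0, d *m M = 0, forall l, 0 <= d 0 l,
    dot d g = 0 & forall l, d 0 l != 0 -> l \in w].
Proof.
move=> ng mS ts sS w3 uw sw /(rays_relation uw)[d [d0 dM dw]].
have dg : dot d g = 0.
  by apply: (relation_dot_eq0 ng ts dM) => l /dw; exact: sw.
have dS : supported d S.
  move=> l /sS sl; apply/eqP/negPn/negP => /dw/sw.
  by rewrite sl ltxx.
have [dge0|dle0] := short_relation_one_signed mS dS dM dg w3 dw.
  by exists d.
exists (- d); split.
- by rewrite oppr_eq0.
- by rewrite mulNmx dM oppr0.
- by move=> l; rewrite mxE oppr_ge0.
- by rewrite dotNl dg oppr0.
- by move=> l; rewrite mxE oppr_eq0; exact: dw.
Qed.

(** Induction on the size of the support: dependent rays in it satisfy a nonnegative relation [d],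
    and subtracting its maximal multiple kills a coordinate. Since [g] is nonnegative and
    [dot d g = 0], [s] changes only where [g] vanishes. *)
Lemma tight_free_support g S s : facet_normal g -> minimal_gen g S ->
  tight g s -> supported s S ->
  exists (t : 'rV_k) (w : seq 'I_k),
    [/\ tight g t, forall l, g l 0 != 0 -> t 0 l = s 0 l, uniq w,
        {subset w <= S} & row_free (rays w) /\ supported t [set l in w]].
Proof.
move=> ng mS; have [n] := ubnP #|[set l | s 0 l != 0]|.
elim: n s => // n IHn s; rewrite ltnS => sn ts sS.
have [[s0 sM] sg] := ts; have [_ g0 _] := ng.
set A := [set l | s 0 l != 0] in sn.
(* Three rays in the plane are dependent, so if the rays of [w] are independent, [w] lists the whole
   support. *)
pose w := take 3 (enum A).
have wA l : l \in w -> l \in A by move/mem_take; rewrite mem_enum.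
have uw : uniq w by rewrite take_uniq// enum_uniq.
have AS l : l \in A -> l \in S.
  by rewrite inE; apply: contraR => /sS ->.
have sw : {in w, forall l, 0 < s 0 l}.
  by move=> l /wA; rewrite inE lt_def s0 andbT.
have [free|nfree] := boolP (row_free (rays w)).
  exists s, w; split=> // [l /wA/AS //|]; split=> // l.
  have [w3|w3] := leqP #|A| 2; last first.
    have /rays_not_free : (2 < size w)%N by rewrite size_takel -?cardE.
    by rewrite free.
  rewrite /w take_oversize; last by rewrite -cardE (leq_trans w3).
  by rewrite !inE mem_enum inE negbK => /eqP.
have [|d [d0 dM dge0 dg dw]] :=
    one_signed_relation ng mS ts sS _ uw sw nfree.
  by rewrite size_take_min geq_minl.
have dgl l : d 0 l * g l 0 = 0.
  move: dg; rewrite dotE => /psumr_eq0P; apply=> // i _.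
  by rewrite mulr_ge0.
have /rV0Pn[l0 dl0] := d0.
have [l|t t0 [tle [l dl sl]]] := maximal_step _ s0 dge0 dl0.
  by move/dw/sw.
have offZ i : g i 0 != 0 -> (s - t *: d) 0 i = s 0 i.
  move=> gi; have /eqP := dgl i; rewrite mulf_eq0 (negPf gi) orbF !mxE.
  by move/eqP->; rewrite mulr0 subr0.
have supp_sub i : s 0 i = 0 -> (s - t *: d) 0 i = 0.
  move=> si; rewrite !mxE si; have [->|/dw/sw] := eqVneq (d 0 i) 0.
    by rewrite mulr0 subr0.
  by rewrite si ltxx.
have := IHn (s - t *: d); case.
- apply: leq_trans sn; apply: proper_card; apply/properP; split.
    apply/fintype.subsetP => i; rewrite !inE.
    by apply: contra => /eqP/supp_sub->.
  exists l; first by rewrite inE gt_eqF// (sw _ (dw _ dl)).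
  by rewrite !inE !mxE sl subrr eqxx.
- split; last by rewrite dotDl dotNl dotZl dg mulr0 subr0.
  split; last by rewrite mulmxBl -scalemxAl dM scaler0 subr0.
  by move=> i; rewrite !mxE subr_ge0.
- by move=> i /sS; exact: supp_sub.
move=> s1 [w1 [ts1 s1Z uw1 w1S fw1]]; exists s1, w1; split => // i gi.
by rewrite s1Z// offZ.
Qed.

Lemma supported_mulmx s S (C : 'M[R]_k) :
  (forall i j, j \notin S -> C i j = 0) -> supported (s *m C) S.
Proof.
by move=> CS j jS; rewrite mxE big1// => i _; rewrite (CS i j jS) mulr0.
Qed.

(** If no tight point on [S] used ray [j], then [s *m C] would vanish at [j] for all tight [s]. As
    these span, column [j] of [C] would be zero, and [C] would witness generation by [S :\ j]. *)
Lemma minimal_gen_covered g S j : facet_normal g -> minimal_gen g S ->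
  j \in S -> exists s, [/\ tight g s, supported s S & 0 < s 0 j].
Proof.
move=> [_ _ uniq] [[C [C0 CM Cg CS]] minS] jS.
have tC s : tight g s -> tight g (s *m C).
  move=> [sf sg]; split; first exact: feasible_mulmx.
  by rewrite dot_mulmx Cg.
apply: contrapT => no_s; apply: (minS j jS); exists C; split=> // i l.
rewrite !inE negb_and negbK => /orP[/eqP->|]; last exact: CS.
have /(congr1 (fun h : 'cV_k => h i 0)) : C *m delta_mx j 0 = 0 :> 'cV[R]_k.
  apply: uniq => s ts; rewrite -dot_mulmx dot_delta_r.
  have [[sC0 _] _] := tC _ ts.
  apply/eqP; move: (sC0 j); rewrite le_eqVlt => /orP[/eqP<-//|sCj].
  exfalso; apply: no_s; exists (s *m C); split=> //; first exact: tC.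
  exact: supported_mulmx.
by rewrite -colE !mxE.
Qed.

(** * Rays in a half plane and lattice points modulo 3 *)

Let half_plane j := (0 < M j 0) || ((M j 0 == 0) && (0 < M j 1)).

Let half_planeP (e : R) j : e = (-1) ^+ (~~ half_plane j) ->
  0 <= e * M j 0 /\ (M j 0 = 0 -> 0 <= e * M j 1).
Proof.
rewrite /half_plane; case: (ltgtP 0 (M j 0)) => /= [||<-] Mj0.
- move=> ->; rewrite expr0 !mul1r ltW//; split=> // Mj.
  by rewrite Mj ltxx in Mj0.
- move=> ->; rewrite expr1 !mulN1r !oppr_ge0 ltW//; split=> // Mj.
  by rewrite Mj ltxx in Mj0.
- rewrite ?eqxx/= mulr0; split=> // _; subst e; case: ltP => Mj1.
    by rewrite expr0 mul1r ltW.
  by rewrite expr1 mulN1r oppr_ge0.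
Qed.

(** The first coordinates have a common sign, so a nonnegative relation makes them vanish; then the
    second coordinates have a common sign too. *)
Let half_plane_relation d (e : R) : (forall l, 0 <= d 0 l) -> d *m M = 0 ->
  (forall l, d 0 l != 0 -> e = (-1) ^+ (~~ half_plane l)) ->
  forall l, d 0 l != 0 -> row l M = 0.
Proof.
move=> d0 dM de.
have sum0 (i : 'I_2) : (forall l, d 0 l != 0 -> 0 <= e * M l i) ->
    forall l, d 0 l != 0 -> M l i = 0.
  move=> eM l dl.
  have e0 : e != 0 by rewrite (de _ dl) signr_eq0.
  have : \sum_l d 0 l * (e * M l i) = 0.
    have /(congr1 (fun v : 'rV_2 => e * v 0 i)) := dM.
    rewrite !mxE mulr0 mulr_sumr => eM0; rewrite -[RHS]eM0.
    by apply: eq_bigr => j _; ring.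
  move=> /psumr_eq0P/(_ l isT)/eqP.
  rewrite !mulf_eq0 (negPf dl) (negPf e0)/= => /(_ _)/eqP; apply=> j _.
  have [->|dj] := eqVneq (d 0 j) 0; first by rewrite mul0r.
  by rewrite mulr_ge0// eM.
have M0 : forall l, d 0 l != 0 -> M l 0 = 0.
  by apply: sum0 => l /de/half_planeP[].
have M1 : forall l, d 0 l != 0 -> M l 1 = 0.
  by apply: sum0 => l dl; have [_] := half_planeP (de _ dl); apply; exact: M0.
move=> l dl; apply/rowP => i; rewrite !mxE.
by case: (ord2_cases i) => ->; [exact: M0|exact: M1].
Qed.

Let mod3 (a : R) : 'I_3 := inord `|(Num.floor a %% 3)%Z|%N.

Let residues s := (mod3 ((f + s *m M) 0 0), mod3 ((f + s *m M) 0 1)).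

Let average3_int (a b c : R) : a \is a Num.int -> b \is a Num.int ->
  c \is a Num.int ->
  mod3 a = mod3 b -> mod3 a = mod3 c -> 3^-1 * (a + b + c) \is a Num.int.
Proof.
move=> /intrP[x ->] /intrP[y ->] /intrP[z ->]; rewrite /mod3 !intrKfloor.
move=> /(congr1 val)/= + /(congr1 val)/=; rewrite !inordK; try lia.
move=> xy xz; have [q xyz] : exists q, (x + y + z = 3 * q)%R.
  by exists ((x + y + z) %/ 3)%Z; lia.
rewrite -!intrD xyz (_ : _ * _ = q%:~R) ?intr_int//.
by rewrite intrM; field.
Qed.

Let tight_average3 g (s1 s2 s3 : 'rV[R]_k) :
  tight g s1 -> tight g s2 -> tight g s3 ->
  residues s1 = residues s2 -> residues s1 = residues s3 ->
  tight g (3^-1 *: (s1 + s2 + s3)).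
Proof.
move=> [[s10 s1M] s1g] [[s20 s2M] s2g] [[s30 s3M] s3g] [r1 r2] [r3 r4].
split; last by rewrite dotZl !dotDl s1g s2g s3g; lra.
split.
  by move=> j; rewrite !mxE; have := s10 j; have := s20 j; have := s30 j; lra.
have -> : f + 3^-1 *: (s1 + s2 + s3) *m M =
    3^-1 *: ((f + s1 *m M) + (f + s2 *m M) + (f + s3 *m M)).
  rewrite -scalemxAl !mulmxDl; apply/rowP => j; rewrite !mxE; lra.
apply/mxOverP => i j; rewrite ord1 [X in X \is a _]mxE [X in _ * X]mxE.
rewrite [X in _ * (X + _)]mxE.
move: s1M s2M s3M => /mxOverP s1M /mxOverP s2M /mxOverP s3M.
by case: (ord2_cases j) => ->; apply: average3_int.
Qed.

(* The average of three tight points that agree modulo 3 is tight, hence every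
   linear relation among the rays of their supports is one for [g] as well;
   three rays of a half plane admit no such relation. *)
Lemma card_minimal_gen g S : facet_normal g -> minimal_gen g S ->
  (#|S| <= 36)%N.
Proof.
move=> ng mS.
have /choice[s sP] : forall j, exists s, j \in S ->
    [/\ tight g s, supported s S & 0 < s 0 j].
  move=> j; have [jS|jS] := boolP (j \in S); last by exists 0.
  by have [s ?] := minimal_gen_covered ng mS jS; exists s.
pose cl j := (residues (s j), half_plane j).
rewrite leqNgt; apply/negP => S36.
have [m m2] : exists m, (2 < #|[set j in S | cl j == m]|)%N.
  apply: contrapT => /forallNP no_m; move: S36; apply/negP; rewrite -leqNgt.
  rewrite -sum1_card (partition_big cl predT)//=.
  (* Nine pairs of residues and two half planes give 18 classes, with at most two rays each. *)
  have -> : 36%N = (\sum_(m : 'I_3 * 'I_3 * bool) 2)%N.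
    by rewrite sum_nat_const !card_prod !card_ord card_bool.
  apply: leq_sum => m _; have /negP := no_m m; rewrite -leqNgt.
  by rewrite -sum1dep_card.
have /card_gt2P[x [y [z [[xm ym zm] [xy yz zx]]]]] := m2.
move: xm ym zm; rewrite !inE.
move=> /andP[xS /eqP xc] /andP[yS /eqP yc] /andP[zS /eqP zc].
have [[[tx Sx x0] [ty Sy y0]] [tz Sz z0]] := (sP _ xS, sP _ yS, sP _ zS).
have clP j : cl j = m -> residues (s j) = m.1 /\ half_plane j = m.2.
  by move=> <-.
have [[[rx hx] [ry hy]] [rz hz]] := (clP _ xc, clP _ yc, clP _ zc).
have tt : tight g (3^-1 *: (s x + s y + s z)).
  by apply: tight_average3; rewrite ?rx.
have St : supported (3^-1 *: (s x + s y + s z)) S.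
  by move=> j jS; rewrite !mxE Sx// Sy// Sz// !addr0 mulr0.
pose w := [:: x; y; z].
have tw : {in w, forall l, 0 < (3^-1 *: (s x + s y + s z)) 0 l}.
  move=> l lw; rewrite !mxE.
  have [[[[sx0 _] _] [[sy0 _] _]] [[sz0 _] _]] := (tx, ty, tz).
  have := sx0 l; have := sy0 l; have := sz0 l.
  by move: lw; rewrite !inE => /or3P[]/eqP->; lra.
have [||d [d0 dM dge0 dg dw]] :=
    @one_signed_relation g S _ w ng mS tt St isT _ tw.
- by rewrite /= !inE !negb_or xy yz eq_sym zx.
- exact: rays_not_free.
(* The half plane forces a ray of the relation to be zero, and a zero ray is by itself a relation
   with a single positive coefficient. *)
have /rV0Pn[l dl] := d0.
have rl0 : row l M = 0.
  apply: (@half_plane_relation d ((-1) ^+ (~~ m.2))) dl => // j.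
  by move=> /dw; rewrite !inE => /or3P[]/eqP->; rewrite ?hx ?hy ?hz.
have lw := dw _ dl.
have delta0 j : (delta_mx 0 l : 'rV[R]_k) 0 j != 0 -> j = l.
  by rewrite mxE /=; have [->|_] := eqVneq j l; rewrite ?andbF ?eqxx.
have lS : l \in S.
  by move: lw; rewrite !inE => /or3P[]/eqP->.
apply: (@no_one_positive_relation g S (delta_mx 0 l) l mS).
- move=> j jS; apply/eqP/negPn/negP => /delta0 jl.
  by rewrite jl lS in jS.
- by rewrite -rowE.
- apply: (relation_dot_eq0 ng tt); first by rewrite -rowE.
  by move=> j /delta0 ->; exact: tw.
- by rewrite mxE !eqxx.
- by move=> j jl; rewrite mxE eqxx (negPf jl).
Qed.

(** * Encoding facet normals *)

(** Equal indices stand for a single nonzero ray, so that one ray and two independent rays are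
    handled alike. *)
Definition basic i j : bool :=
  if i == j then row i M != 0 else M i 0 * M j 1 - M i 1 * M j 0 != 0.

Lemma basicC i j : basic i j = basic j i.
Proof.
rewrite /basic eq_sym; have [->//|_] := eqVneq j i.
by rewrite -oppr_eq0; congr (_ != 0); ring.
Qed.

Lemma tight_basic_support g S s : facet_normal g -> minimal_gen g S ->
  tight g s -> supported s S ->
  exists t i j, [/\ tight g t, forall l, g l 0 != 0 -> t 0 l = s 0 l,
    i \in S, j \in S & basic i j /\ supported t [set i; j]].
Proof.
move=> ng mS ts sS.
have [t [w [tt tZ uw wS [fw tw]]]] := tight_free_support ng mS ts sS.
have : (size w <= 2)%N.
  by rewrite leqNgt; apply/negP => /rays_not_free; rewrite fw.
have /row_freeP[B] := fw.
case: w uw wS tw {fw} B => [|i [|j [|//]]] uw wS tw B rB _.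
- have t0 : t = 0.
    by apply/rowP => l; rewrite mxE tw// !inE.
  by have [_] := tt; rewrite t0 dot0l => /eqP; rewrite eq_sym oner_eq0.
- have iS : i \in S by apply: wS; rewrite inE.
  exists t, i, i; split=> //; split; last first.
    by move=> l; rewrite !inE orbb => li; apply: tw; rewrite !inE.
  rewrite /basic eqxx; apply/negP => /eqP ri0.
  have /matrixP/(_ ord0 ord0) := rB; rewrite mxE big1 ?mxE => [/eqP|a _].
    by rewrite eq_sym oner_eq0.
  have /rowP/(_ a) := ri0; rewrite !mxE => Mia.
  by rewrite (tnth_nth i)/= Mia mul0r.
- have iS : i \in S by apply: wS; rewrite !inE eqxx.
  have jS : j \in S by apply: wS; rewrite !inE eqxx orbT.
  exists t, i, j; split=> //; split; last first.
    by move=> l; rewrite !inE => lij; apply: tw; rewrite !inE.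
  have ij : (i == j) = false.
    by move: uw; rewrite /= inE andbT => /negPf.
  rewrite /basic ij; apply/negP => /eqP det0.
  have entry (a a' : 'I_2) :
      \sum_(l < 2) M (tnth (in_tuple [:: i; j]) a) l * B l a' = (a == a')%:R.
    have /matrixP/(_ a a') := rB; rewrite !mxE => <-.
    by apply: eq_bigr => l _; rewrite /rays !mxE.
  have e00 := entry 0 0; have e01 := entry 0 1.
  have e10 := entry 1 0; have e11 := entry 1 1.
  rewrite !sum_ord2 !(tnth_nth i) /= in e00 e01 e10 e11.
  have : (M i 0 * M j 1 - M i 1 * M j 0) * (B 0 0 * B 1 1 - B 0 1 * B 1 0) = 1.
    transitivity ((M i 0 * B 0 0 + M i 1 * B 1 0) *
        (M j 0 * B 0 1 + M j 1 * B 1 1) -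
        (M i 0 * B 0 1 + M i 1 * B 1 1) * (M j 0 * B 0 0 + M j 1 * B 1 0)).
      by ring.
    by rewrite e00 e01 e10 e11 mulr1 mul0r subr0.
  by rewrite det0 mul0r => /eqP; rewrite eq_sym oner_eq0.
Qed.

(** * Lexicographic minima and extreme points on two rays *)

Definition lexmin g i j e : Prop :=
  [/\ tight g e, supported e [set i; j] &
      forall x, tight g x -> supported x [set i; j] ->
        e 0 i <= x 0 i /\ (x 0 i = e 0 i -> e 0 j <= x 0 j)].

(** No normal occurs here, so points coming from different normals can be compared. The bound by
    [2 * e 0 l] says that the reflection [2 *: e - x] is nonnegative. *)
Definition extreme i j e : Prop :=
  [/\ feasible e, supported e [set i; j] &
      forall x, feasible x -> supported x [set i; j] ->
        (forall l, x 0 l <= 2 * e 0 l) -> x = e].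

Lemma supported2_ext i j s c : supported s [set i; j] ->
  supported c [set i; j] -> s 0 i = c 0 i -> s 0 j = c 0 j -> s = c.
Proof.
move=> sij cij si sj; apply/rowP => l.
have [|lij] := boolP (l \in [set i; j]); last by rewrite sij// cij.
by rewrite !inE => /orP[]/eqP->.
Qed.

(** The values of [x] and of its reflection in [e] are at least 1 and average to 1, so both points
    are tight; minimality of [e] against both gives [x = e]. *)
Lemma lexmin_extreme g i j e : facet_normal g -> lexmin g i j e ->
  extreme i j e.
Proof.
move=> [valid _ _] [[[e0 eM] eg] eij emin]; split=> // x [x0 xM] xij xle.
have yf : feasible (2 *: e - x).
  split; first by move=> l; rewrite !mxE subr_ge0.
  have -> : f + (2 *: e - x) *m M = 2 *: (f + e *m M) - (f + x *m M).
    by rewrite mulmxBl -scalemxAl; apply/rowP => l; rewrite !mxE; ring.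
  apply/mxOverP => a b; rewrite !mxE.
  move: eM xM => /mxOverP/(_ a b) + /mxOverP/(_ a b); rewrite !mxE => eM xM.
  by rewrite rpredB ?rpredM ?rpred_nat.
have yij : supported (2 *: e - x) [set i; j].
  by move=> l lij; rewrite !mxE xij// eij// mulr0 subr0.
have yg := valid _ yf; have xg := valid x (conj x0 xM).
rewrite dotDl dotNl dotZl eg in yg.
have xt : tight g x by split=> //; lra.
have yt : tight g (2 *: e - x).
  by split=> //; rewrite dotDl dotNl dotZl eg; lra.
have [xi xj] := emin _ xt xij; have [yi yj] := emin _ yt yij.
rewrite !mxE in yi yj.
have xei : x 0 i = e 0 i by lra.
apply: (supported2_ext xij eij xei).
by have := xj xei; have := yj; rewrite xei => /(_ ltac:(ring)); lra.
Qed.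

(** Otherwise [e + q *: delta_mx 0 l] would be a feasible point below [2 *: e] and different from
    [e]. *)
Lemma extreme_lt i j e l (q : R) : extreme i j e -> l \in [set i; j] ->
  0 < q -> q *: row l M \is a mxOver (Num.int : {pred R}) -> e 0 l < q.
Proof.
move=> [[e0 eM] eij emax] lij q0 ql; rewrite ltNge; apply/negP => qe.
have : e + q *: delta_mx 0 l = e.
  apply: emax.
  - split; first by move=> a; rewrite !mxE addr_ge0// mulr_ge0// ltW.
    rewrite mulmxDl -scalemxAl -rowE addrA; apply/mxOverP => a b.
    by rewrite mxE rpredD//; [move/mxOverP: eM|move/mxOverP: ql]; apply.
  - move=> a aij; rewrite !mxE eij// add0r /=.
    have [al|_] := eqVneq a l; last by rewrite mulr0.
    by rewrite al lij in aij.
  - move=> a; rewrite !mxE eqxx/=; have [->|_] := eqVneq a l => /=.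
      by lra.
    by have := e0 a; lra.
move=> /rowP/(_ l); rewrite !mxE !eqxx/=; lra.
Qed.

Lemma dot_supported2 i j s g : supported s [set i; j] ->
  dot s g = if i == j then s 0 i * g i 0 else s 0 i * g i 0 + s 0 j * g j 0.
Proof.
move=> sij; rewrite dotE (bigD1 i)//=; have [ij|ij] := eqVneq i j.
  rewrite big1 ?addr0// => l lj.
  by rewrite sij ?mul0r// !inE -ij orbb.
rewrite (bigD1 j) 1?eq_sym//= big1 ?addr0// => l /andP[li lj].
by rewrite sij ?mul0r// !inE negb_or li.
Qed.

(* The tight points on two rays lie on a segment with endpoints the two
   lexicographic minima, unless [g] vanishes on one of the rays. *)
Lemma lexmin_endpoints g h i j e e' s : facet_normal g -> lexmin g i j e ->
  lexmin g j i e' -> (g i 0 = 0 -> h i 0 = 0) -> (g j 0 = 0 -> h j 0 = 0) ->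
  dot e h = 0 -> dot e' h = 0 -> tight g s -> supported s [set i; j] ->
  dot s h = 0.
Proof.
move=> [_ g0 _] [te eij emin] [te' e'ji emin'] hi hj eh e'h ts sij.
have e'ij : supported e' [set i; j] by rewrite finset.setUC.
have [ei _] := emin _ ts sij.
have [] := emin' _ ts; first by rewrite finset.setUC.
move=> e'j _.
have [_ eg] := te; have [_ e'g] := te'; have [_ sg] := ts.
move: eg e'g sg eh e'h; rewrite !(@dot_supported2 i j)//.
have [ij|ij] := eqVneq i j => eg e'g sg eh e'h.
  have gi : g i 0 != 0.
    by apply/eqP => gi; move: sg => /eqP; rewrite gi mulr0 eq_sym oner_eq0.
  have -> : s 0 i = e 0 i by apply: (mulIf gi); rewrite sg eg.
  exact: eh.
have [gi|gi] := eqVneq (g i 0) 0.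
  have gj : g j 0 != 0.
    apply/eqP => gj; move: sg => /eqP.
    by rewrite gi gj !mulr0 addr0 eq_sym oner_eq0.
  move: eh; rewrite hi// !mulr0 !add0r; suff -> : s 0 j = e 0 j by [].
  by apply: (mulIf gj); move: sg eg; rewrite gi !mulr0 !add0r => -> ->.
have [gj|gj] := eqVneq (g j 0) 0.
  move: eh; rewrite hj// !mulr0 !addr0; suff -> : s 0 i = e 0 i by [].
  by apply: (mulIf gi); move: sg eg; rewrite gj !mulr0 !addr0 => -> ->.
have {}gi : 0 < g i 0 by rewrite lt_def gi g0.
have {}gj : 0 < g j 0 by rewrite lt_def gj g0.
have [ee'|ee'] := eqVneq (e 0 i) (e' 0 i).
  have eej : e 0 j = e' 0 j by nra.
  have sei : s 0 i = e 0 i by nra.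
  have sej : s 0 j = e 0 j by nra.
  by rewrite sei sej.
have sjE : s 0 j * g j 0 = 1 - s 0 i * g i 0 by lra.
have ejE : e 0 j * g j 0 = 1 - e 0 i * g i 0 by lra.
have e'jE : e' 0 j * g j 0 = 1 - e' 0 i * g i 0 by lra.
(* The point [s] lies on the line through [e] and [e'], written here without denominators. *)
have conv : (e' 0 i - e 0 i) * s 0 j =
    (e' 0 i - s 0 i) * e 0 j + (s 0 i - e 0 i) * e' 0 j.
  apply: (mulIf (lt0r_neq0 gj)).
  transitivity ((e' 0 i - e 0 i) * (s 0 j * g j 0)); first by ring.
  transitivity ((e' 0 i - s 0 i) * (e 0 j * g j 0) +
    (s 0 i - e 0 i) * (e' 0 j * g j 0)); last by ring.
  by rewrite sjE ejE e'jE; ring.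
have ee'0 : e' 0 i - e 0 i != 0 by rewrite subr_eq0 eq_sym.
apply: (mulfI ee'0); rewrite mulr0 mulrDr !mulrA conv.
have := congr1 ( *%R (e' 0 i - s 0 i)) eh.
have := congr1 ( *%R (s 0 i - e 0 i)) e'h.
rewrite !mulr0 => h1 h2; rewrite -[RHS]addr0 -{1}h1 -h2; ring.
Qed.

Lemma min_nat_valued (T : Type) (P : T -> Prop) (u : T -> R) :
  (exists x, P x) -> (forall x, P x -> u x \is a Num.nat) ->
  exists2 x, P x & forall y, P y -> u x <= u y.
Proof.
move=> [x0 Px0] unat.
have ex : exists n, `[< exists2 x, P x & u x = n%:R >].
  have /natrP[n un] := unat _ Px0.
  by exists n; apply/asboolP; exists x0.
have [n /asboolP[x Px xn] nmin] := ex_minnP ex.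
exists x => // y Py; have /natrP[m ym] := unat _ Py.
by rewrite xn ym ler_nat; apply: nmin; apply/asboolP; exists y.
Qed.

Lemma lexmin_exists g i j s (n : nat) : (0 < n)%N ->
  (forall s, feasible s -> supported s [set i; j] ->
    forall l, n%:R * s 0 l \is a Num.nat) ->
  tight g s -> supported s [set i; j] -> exists e, lexmin g i j e.
Proof.
move=> n0 grid ts sij.
have nle (x y : 'rV[R]_k) l : n%:R * x 0 l <= n%:R * y 0 l -> x 0 l <= y 0 l.
  by rewrite ler_pM2l// ltr0n.
pose P x := tight g x /\ supported x [set i; j].
have [||a [ta aij] amin] := @min_nat_valued _ P (fun x => n%:R * x 0 i).
- by exists s.
- by move=> x [[xf _] xij]; exact: grid.
pose Q x := P x /\ x 0 i = a 0 i.
have [||e [[te eij] ei] emin] := @min_nat_valued _ Q (fun x => n%:R * x 0 j).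
- by exists a.
- by move=> x [[[xf _] xij] _]; exact: grid.
exists e; split=> // x tx xij; rewrite ei; split; first exact/nle/amin.
by move=> xi; apply/nle/emin.
Qed.

Variables (n : 'I_k -> 'I_k -> nat) (L : nat).
Hypothesis n_gt0 : forall i j, basic i j -> (0 < n i j)%N.
Hypothesis n_grid : forall i j s, basic i j -> feasible s ->
  supported s [set i; j] -> forall l, (n i j)%:R * s 0 l \is a Num.nat.

Definition grid_coord i j e l : nat := Num.truncn ((n i j)%:R * e 0 l).

Hypothesis n_bits : forall i j e, basic i j -> extreme i j e ->
  forall l, (up_log 2 (grid_coord i j e l).+1 <= L)%N.

(** On extreme points of a basic pair [inord] loses nothing, by [n_bits]. *)
Definition box i j e : 'I_L.+1 * 'I_L.+1 :=
  (inord (up_log 2 (grid_coord i j e i).+1),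
   inord (up_log 2 (grid_coord i j e j).+1)).

(* If [e] and [e'] lie in the same dyadic box, then [2 e - e'] is feasible,
   and [e] is the midpoint of [e'] and [2 e - e']. *)
Lemma box_inj i j e e' : basic i j -> extreme i j e -> extreme i j e' ->
  box i j e = box i j e' -> e = e'.
Proof.
move=> bij ee ee' [/(congr1 val) + /(congr1 val)].
have [ef eij emax] := ee; have [e'f e'ij _] := ee'.
rewrite /= !inordK ?ltnS ?n_bits// => boxi boxj.
have double l : up_log 2 (grid_coord i j e l).+1 =
    up_log 2 (grid_coord i j e' l).+1 -> e' 0 l <= 2 * e 0 l.
  move/esym/same_bits_le_double; rewrite /grid_coord.
  have /natrP[a ea] := n_grid bij ef eij l.
  have /natrP[b eb] := n_grid bij e'f e'ij l.
  have n0 : 0 < (n i j)%:R :> R by rewrite ltr0n n_gt0.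
  rewrite ea eb !natrK -(ler_pM2l n0) eb mulrCA ea => ba.
  by rewrite -natrM ler_nat mul2n.
apply/esym/emax => // l; have [|lij] := boolP (l \in [set i; j]).
  by rewrite !inE => /orP[]/eqP->; apply: double.
by rewrite e'ij// eij// mulr0.
Qed.

(* An enumeration of a minimal generating set [S], the zero pattern of the normal
   on [S], and for each pair of rays of [S] the box of its lexmin, if any. *)
Definition normal_code : finType :=
  ({ffun 'I_36 -> option 'I_k} * {ffun 'I_36 -> bool} *
   {ffun 'I_36 * 'I_36 -> option ('I_L.+1 * 'I_L.+1)})%type.

Definition encodes g (m : normal_code) : Prop :=
  exists S, [/\ minimal_gen g S,
    forall j, j \in S <-> exists a, m.1.1 a = Some j,
    forall a j, m.1.1 a = Some j -> m.1.2 a = (g j 0 == 0) &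
    forall a b i j, m.1.1 a = Some i -> m.1.1 b = Some j -> basic i j ->
      (forall e, lexmin g i j e -> m.2 (a, b) = Some (box i j e)) /\
      (m.2 (a, b) <> None -> exists e, lexmin g i j e)].

Lemma lexmin_unique g i j e e' : lexmin g i j e -> lexmin g i j e' -> e = e'.
Proof.
move=> [te eij emin] [te' e'ij emin'].
have [ei ej] := emin _ te' e'ij; have [e'i e'j] := emin' _ te eij.
have eei : e 0 i = e' 0 i by lra.
apply: (supported2_ext eij e'ij) => //.
by have := ej (esym eei); have := e'j eei; lra.
Qed.

Lemma encodes_exists g : facet_normal g -> exists m, encodes g m.
Proof.
move=> ng; have [S mS] := minimal_gen_exists g.
have S36 := card_minimal_gen ng mS.
(* The default [None] pads the enumeration of [S] to 36 entries. *)
pose x (a : 'I_36) : option 'I_k := nth None [seq Some j | j <- enum S] a.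
have xS j : j \in S <-> exists a, x a = Some j.
  split=> [jS|[a]].
    have jlt : (index j (enum S) < 36)%N.
      by apply: leq_trans S36; rewrite cardE index_mem mem_enum.
    exists (Ordinal jlt); rewrite /x (nth_map j) ?index_mem ?mem_enum//=.
    by rewrite nth_index ?mem_enum.
  rewrite /x; have [alt|age] := ltnP a (size (enum S)); last first.
    by rewrite nth_default// size_map.
  case: (enum S) (mem_enum (mem S)) alt => // j0 w wS alt.
  by rewrite (nth_map j0)// => -[<-]; rewrite -wS mem_nth.
have /fin_all_exists[b bP] : forall ab : 'I_36 * 'I_36, exists o,
    forall i j, x ab.1 = Some i -> x ab.2 = Some j ->
    (forall e, lexmin g i j e -> o = Some (box i j e)) /\
    (o <> None -> exists e, lexmin g i j e).
  move=> [a a'] /=; case: (x a) => [i|]; last by exists None.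
  case: (x a') => [j|]; last by exists None.
  have [[e emin]|no_e] := pselect (exists e, lexmin g i j e).
    exists (Some (box i j e)) => _ _ [<-] [<-]; split=> [e' e'min|_].
      by rewrite (lexmin_unique emin e'min).
    by exists e.
  exists None => _ _ [<-] [<-]; split=> // e emin.
  by exfalso; apply: no_e; exists e.
exists ([ffun a => x a],
  [ffun a => if x a is Some j then g j 0 == 0 else false],
  [ffun ab => b ab]); exists S; split=> //=.
- move=> j; rewrite xS; split=> -[a xa]; exists a; move: xa; rewrite ffunE//.
- by move=> a j; rewrite !ffunE => ->.
- by move=> a a' i j; rewrite !ffunE => xa xa' _; exact: (bP (a, a')).
Qed.

(** Equal codes give equal lexmins, on which [g' - g] vanishes; so it vanishes on all tight points
    of [g] supported on [S], such as [s *m C] for tight [s]. As the tight points span,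
    [C *m g' = C *m g = g], and subadditivity of [g'] bounds [g'] by [C *m g']. *)
Let encodes_le g g' m : facet_normal g -> facet_normal g' ->
  encodes g m -> encodes g' m -> forall i, g' i 0 <= g i 0.
Proof.
move=> ng ng' [S [mS mx mz mb]] [S' [mS' mx' mz' mb']] i.
have [[C [C0 CM Cg CS]] _] := mS; have [_ _ uniq] := ng.
have zero j : j \in S -> g j 0 = 0 -> (g' - g) j 0 = 0.
  move=> /mx[a xa] gj; have := mz' _ _ xa; rewrite (mz _ _ xa) gj eqxx.
  by move=> /esym/eqP g'j; rewrite !mxE g'j gj subr0.
have lexmin_dot j l e : j \in S -> l \in S -> basic j l -> lexmin g j l e ->
    dot e (g' - g) = 0.
  move=> /mx[a xa] /mx[b xb] bjl emin.
  have [/(_ _ emin) boxe _] := mb _ _ _ _ xa xb bjl.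
  (* The entry is not [None], so [g'] has a lexmin on these rays as well. *)
  have [boxe' []] := mb' _ _ _ _ xa xb bjl; first by rewrite boxe.
  move=> e' e'min; have := boxe' _ e'min; rewrite boxe => /Some_inj bb.
  have ee' :=
    box_inj bjl (lexmin_extreme ng emin) (lexmin_extreme ng' e'min) bb.
  have [[_ eg] _ _] := emin; have [[_ e'g'] _ _] := e'min.
  by rewrite dotDr dotNr eg ee' e'g' subrr.
have tight_dot t : tight g t -> supported t S -> dot t (g' - g) = 0.
  move=> tt tS.
  have [s [j [l [ts sZ jS lS [bjl sjl]]]]] := tight_basic_support ng mS tt tS.
  (* The points differ only where [g] vanishes. There [g'] vanishes too if the ray is in [S], by the
     recorded zero pattern; off [S] both points are zero. *)
  have -> : dot t (g' - g) = dot s (g' - g).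
    rewrite !dotE; apply: eq_bigr => a _.
    have [ga|ga] := eqVneq (g a 0) 0; last by rewrite sZ.
    have [aS|aS] := boolP (a \in S); first by rewrite zero// !mulr0.
    rewrite tS// sjl// !inE; apply/negP => /orP[]/eqP aE.
      by rewrite aE jS in aS.
    by rewrite aE lS in aS.
  have blj : basic l j by rewrite basicC.
  have slj : supported s [set l; j] by rewrite finset.setUC.
  have [e emin] := lexmin_exists (n_gt0 bjl)
    (fun s sf => n_grid bjl sf) ts sjl.
  have [e' e'min] := lexmin_exists (n_gt0 blj)
    (fun s sf => n_grid blj sf) ts slj.
  apply: (lexmin_endpoints ng emin e'min) => //; try exact: zero.
  - exact: (lexmin_dot _ _ _ jS lS bjl).
  - exact: (lexmin_dot _ _ _ lS jS blj).
have Cgg' : C *m (g' - g) = 0.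
  apply: uniq => s [sf sg]; rewrite -dot_mulmx; apply: tight_dot.
    by split; [exact: feasible_mulmx|rewrite dot_mulmx Cg].
  exact: supported_mulmx.
have Cg' : C *m g' = g.
  by apply/eqP; rewrite -subr_eq0 -[X in _ - X]Cg -mulmxBr Cgg'.
rewrite -Cg' -row_dot.
apply: (facet_normal_subadditive ng').
  by move=> j; rewrite mxE.
by rewrite -row_mul CM.
Qed.

Lemma encodes_inj g g' m : facet_normal g -> facet_normal g' ->
  encodes g m -> encodes g' m -> g = g'.
Proof.
move=> ng ng' gm g'm; apply/colP => i.
by apply/le_anti; rewrite (encodes_le ng' ng g'm gm) (encodes_le ng ng' gm g'm).
Qed.

Lemma card_normal_code : #|{: normal_code}| =
  ((k.+1 ^ 36 * 2 ^ 36) * ((L.+1 * L.+1).+1 ^ (36 * 36)))%N.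
Proof.
by rewrite !card_prod !card_ffun card_bool !card_option !card_prod !card_ord.
Qed.

End FacetNormals.

(** * Rational data *)

Lemma ratr_numq (R : archiRealFieldType) (x : rat) :
  (denq x)%:~R * ratr x = (numq x)%:~R :> R.
Proof.
rewrite -[x in ratr x]divq_num_den fmorph_div/= !ratr_int.
by rewrite mulrC divfK// intr_eq0.
Qed.

Section RationalData.
Variables (R : archiRealFieldType) (k : nat).
Variables (f : 'rV[rat]_2) (r : 'I_k -> 'rV[rat]_2).

Definition denom (x : 'rV[rat]_2) : int := denq (x 0 0) * denq (x 0 1).

Lemma denom_gt0 x : 0 < denom x.
Proof. by rewrite mulr_gt0. Qed.

Definition ray_matrix : 'M[R]_(k, 2) := \matrix_j map_mx ratr (r j).
Local Notation fR := (map_mx ratr f : 'rV[R]_2).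
Local Notation M := ray_matrix.

Lemma denom_int (x : 'rV[rat]_2) c :
  (denom x)%:~R * ratr (x 0 c) \is a @Num.int R.
Proof.
rewrite /denom rmorphM/=; case: (ord2_cases c) => ->.
  by rewrite mulrAC ratr_numq rpredM// intr_int.
by rewrite -mulrA ratr_numq rpredM// intr_int.
Qed.

Lemma denom_row j :
  (denom (r j))%:~R *: row j M \is a mxOver (Num.int : {pred R}).
Proof.
by apply/mxOverP => a c; rewrite !mxE; exact: denom_int.
Qed.

Definition numer_det i j : int :=
  numq (r i 0 0) * numq (r j 0 1) * (denq (r i 0 1) * denq (r j 0 0)) -
  numq (r i 0 1) * numq (r j 0 0) * (denq (r i 0 0) * denq (r j 0 1)).

Definition numer_ray i : int :=
  if r i 0 0 != 0 then numq (r i 0 0) else numq (r i 0 1).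

(* By Cramer's rule, a common denominator of the coordinates of the feasible
   points supported on a basic pair [i, j]. *)
Definition grid i j : nat :=
  `|(denom f * if i == j then numer_ray i else numer_det i j)%R|%N.

Lemma ray_matrixE j c : M j c = ratr (r j 0 c).
Proof. by rewrite !mxE. Qed.

Lemma numer_detE i j : (numer_det i j)%:~R =
  (denom (r i))%:~R * (denom (r j))%:~R * (M i 0 * M j 1 - M i 1 * M j 0).
Proof.
rewrite !ray_matrixE /numer_det /denom rmorphB !rmorphM/= -!ratr_numq; ring.
Qed.

Lemma grid_gt0 i j : basic M i j -> (0 < grid i j)%N.
Proof.
rewrite /basic /grid absz_gt0 mulf_eq0 (gt_eqF (denom_gt0 f)) /=.
have [_|_] := eqVneq i j; last first.
  by rewrite -(intr_eq0 R) numer_detE !mulf_eq0 !intr_eq0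
    !(gt_eqF (denom_gt0 _)).
move=> ri; rewrite /numer_ray; have [ri0|ri0] := eqVneq (r i 0 0) 0 => /=.
  rewrite numq_eq0; apply: contra ri => /eqP ri1; apply/eqP/rowP => c.
  by rewrite !mxE; case: (ord2_cases c) => ->; rewrite ?ri0 ?ri1 rmorph0.
by rewrite numq_eq0.
Qed.

Lemma grid_nat i j s : basic M i j -> feasible fR M s ->
  supported s [set i; j] -> forall l, (grid i j)%:R * s 0 l \is a Num.nat.
Proof.
move=> bij [s0 /mxOverP sM] sij l.
have [lij|lij] := boolP (l \in [set i; j]); last first.
  by rewrite sij// mulr0 nat_num0.
rewrite /grid natr_absz intr_norm -[s 0 l]ger0_norm// -normrM natr_norm_int//.
(* As [f + s *m M] is integral, [denom f] clears the denominators of [s *m M]. *)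
have qu c : (denom f)%:~R * (s *m M) 0 c \is a Num.int.
  have := sM 0 c; rewrite mxE [X in X + _]mxE => sMc.
  rewrite -[X in _ * X](addKr (ratr (f 0 c))) mulrDr rpredD//.
    by rewrite mulrN rpredN denom_int.
  by rewrite rpredM ?intr_int.
have sME c : (s *m M) 0 c =
    if i == j then s 0 i * M i c else s 0 i * M i c + s 0 j * M j c.
  have -> : (s *m M) 0 c = dot s (col c M).
    by rewrite dotE mxE; apply: eq_bigr => a _; rewrite [in RHS]mxE.
  by rewrite (dot_supported2 _ sij) ![col _ _ _ _]mxE.
move: lij; rewrite !inE; have [ij|ij] := eqVneq i j => lij.
  have {lij} -> : l = i by case/orP: lij => /eqP->.
  have num c : (numer_ray i = numq (r i 0 c)) ->
      (denom f * numer_ray i)%:~R * s 0 i \is a @Num.int R.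
    move=> ->; rewrite intrM -ratr_numq -ray_matrixE.
    have := qu c; rewrite sME ij eqxx -ij => qc.
    rewrite (_ : _ * _ = (denq (r i 0 c))%:~R *
      ((denom f)%:~R * (s 0 i * M i c))); last by ring.
    by rewrite rpredM ?intr_int.
  by move: (num 0) (num 1); rewrite /numer_ray; case: ifP => _ num0 num1;
    [exact: num0|exact: num1].
rewrite intrM numer_detE.
have [u0 u1] := (qu 0, qu 1); rewrite !sME (negPf ij) in u0 u1.
have [a0 a1] := (denom_int (r i) 0, denom_int (r i) 1).
have [b0 b1] := (denom_int (r j) 0, denom_int (r j) 1).
rewrite -!ray_matrixE in a0 a1 b0 b1.
(* Eliminating one unknown from the two coordinate equations leaves the other one times the
   determinant. *)
case/orP: lij => /eqP->.
  rewrite (_ : _ * s 0 i = (denom (r i))%:~R *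
    ((denom f)%:~R * (s 0 i * M i 0 + s 0 j * M j 0) *
       ((denom (r j))%:~R * M j 1) -
     (denom f)%:~R * (s 0 i * M i 1 + s 0 j * M j 1) *
       ((denom (r j))%:~R * M j 0))); last by ring.
  by rewrite rpredM ?intr_int// rpredB// rpredM.
rewrite (_ : _ * s 0 j = (denom (r j))%:~R *
  ((denom f)%:~R * (s 0 i * M i 1 + s 0 j * M j 1) *
     ((denom (r i))%:~R * M i 0) -
   (denom f)%:~R * (s 0 i * M i 0 + s 0 j * M j 0) *
     ((denom (r i))%:~R * M i 1))); last by ring.
by rewrite rpredM ?intr_int// rpredB// rpredM.
Qed.

Local Notation size := (data_size f r).

Lemma rat_size_num x : (`|numq x| <= 2 ^ rat_size x)%N.
Proof.
apply: (@leq_trans (2 ^ up_log 2 (`|numq x| + 1))).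
  by apply: leq_trans (up_logP _ _); rewrite ?leq_addr.
by rewrite leq_exp2l// /rat_size addnAC leq_addl.
Qed.

Lemma rat_size_den x : (`|denq x| <= 2 ^ rat_size x)%N.
Proof.
apply: (@leq_trans (2 ^ up_log 2 (`|denq x| + 1))).
  by apply: leq_trans (up_logP _ _); rewrite ?leq_addr.
by rewrite leq_exp2l// /rat_size leq_addl.
Qed.

Lemma rV_size_coord (x : 'rV[rat]_2) c : (rat_size (x 0%R c) <= rV_size x)%N.
Proof. by rewrite /rV_size (bigD1 c)//= addnCA leq_addr. Qed.

Lemma rV_size_ray j : (rV_size (r j) <= size)%N.
Proof. by rewrite /data_size (bigD1 j)//= addnCA leq_addr. Qed.

Lemma dimension_le_size : (k <= size)%N.
Proof.
apply: leq_trans (leq_addl _ _); rewrite -[leqLHS]card_ord -sum1_card.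
by apply: leq_sum => j _; rewrite /rV_size.
Qed.

Let coord_bound (x : 'rV[rat]_2) c : (rV_size x <= size)%N ->
  (`|numq (x 0%R c)| <= 2 ^ size)%N /\ (`|denq (x 0%R c)| <= 2 ^ size)%N.
Proof.
move=> xs; have le_pow : (2 ^ rat_size (x 0%R c) <= 2 ^ size)%N.
  by rewrite leq_exp2l// (leq_trans _ xs)// rV_size_coord.
by split; apply: leq_trans le_pow; rewrite ?rat_size_num ?rat_size_den.
Qed.

Let denom_bound x : (rV_size x <= size)%N -> (`|denom x| <= 2 ^ (2 * size))%N.
Proof.
move=> xs; rewrite mul2n -addnn expnD abszM leq_mul//.
  by have [] := coord_bound 0 xs.
by have [] := coord_bound 1 xs.
Qed.

Let numer_det_bound i j : (`|numer_det i j| <= 2 ^ (4 * size).+1)%N.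
Proof.
have [a0 b0] := coord_bound 0 (rV_size_ray i).
have [a1 b1] := coord_bound 1 (rV_size_ray i).
have [c0 d0] := coord_bound 0 (rV_size_ray j).
have [c1 d1] := coord_bound 1 (rV_size_ray j).
rewrite /numer_det.
set x := (X in X - _); set y := (X in _ - X).
apply: (@leq_trans (`|x| + `|y|)); first by lia.
have -> : (2 ^ (4 * size).+1 = 2 ^ size * 2 ^ size * (2 ^ size * 2 ^ size) +
    2 ^ size * 2 ^ size * (2 ^ size * 2 ^ size))%N.
  by rewrite addnn -mul2n expnS -!expnD; congr (_ * 2 ^ _)%N; lia.
by rewrite leq_add// !abszM !leq_mul.
Qed.

Lemma grid_bound i j l : (grid i j * `|denom (r l)| <= 2 ^ (8 * size).+1)%N.
Proof.
have fs : (rV_size f <= size)%N by exact: leq_addr.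
(* The three factors bound [denom f], the determinant or ray numerator, and [denom (r l)]. *)
apply: (@leq_trans (2 ^ (2 * size) * 2 ^ (4 * size).+1 * 2 ^ (2 * size))).
  rewrite leq_mul ?denom_bound ?rV_size_ray// /grid abszM.
  rewrite leq_mul ?denom_bound//.
  case: ifP => _; last exact: numer_det_bound.
  apply: (@leq_trans (2 ^ size)); last by rewrite leq_exp2l//; lia.
  have [a0 _] := coord_bound 0 (rV_size_ray i).
  have [a1 _] := coord_bound 1 (rV_size_ray i).
  by rewrite /numer_ray; case: ifP.
by rewrite -!expnD leq_exp2l//; lia.
Qed.

(** The multiple of ray [l] by [denom (r l)] is integral, so [extreme_lt] bounds the coordinate by
    [denom (r l)]. *)
Lemma grid_bits i j e : basic M i j -> extreme fR M i j e ->
  forall l, (up_log 2 (grid_coord grid i j e l).+1 <= (8 * size).+1)%N.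
Proof.
move=> bij ee l; rewrite /grid_coord; have [ef eij _] := ee.
have [lij|lij] := boolP (l \in [set i; j]); last first.
  by rewrite eij// mulr0 truncn0.
apply: up_log_min => //; apply: leq_trans (grid_bound i j l).
have q0 : 0 < (denom (r l))%:~R :> R by rewrite ltr0z denom_gt0.
have el := extreme_lt ee lij q0 (denom_row l).
have [e0 _] := ef.
rewrite truncn_lt_nat ?mulr_ge0// natrM [X in _ < _ * X]natr_absz.
rewrite gtr0_norm ?denom_gt0//.
by rewrite ltr_pM2l// ltr0n grid_gt0.
Qed.

End RationalData.

(** * Facets of the mixed integer hull *)

Local Open Scope classical_set_scope.
Local Open Scope ring_scope.

Section ConvexHull.
Variables (R : realType) (k : nat).
Implicit Types (A X : set 'rV[R]_k) (x y : 'rV[R]_k).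

Lemma convex_hull_min A (X : set 'rV[R]_k) : A `<=` X ->
  (forall x y (t : R), 0 < t -> t < 1 -> X x -> X y ->
     X (t *: x + (1 - t) *: y)) ->
  convex_hull A `<=` X.
Proof.
move=> AX cX; apply: smallest_sub => //; apply/convex_setW => x y xX yX t t0 t1.
by rewrite inE; apply: cX => //; [move: xX|move: yX]; rewrite inE.
Qed.

Lemma sub_convex_hull A : A `<=` convex_hull A.
Proof. exact: sub_gen_smallest. Qed.

Lemma convex_hull_ge0 A : (forall x, A x -> forall j, 0 <= x 0 j) ->
  forall x, convex_hull A x -> forall j, 0 <= x 0 j.
Proof.
move=> A0; apply: convex_hull_min => // x y t t0 t1 x0 y0 j.
by rewrite !mxE addr_ge0// mulr_ge0 ?subr_ge0// ltW.
Qed.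

(** A proper convex combination of values at least 1 equals 1 only if both values do; so an equation
    on the tight points extends to the face of the hull. *)
Lemma convex_hull_dot_eq A (g h : 'cV[R]_k) :
  (forall x, A x -> 1 <= dot x g) ->
  (forall x, A x -> dot x g = 1 -> dot x h = 0) ->
  forall x, convex_hull A x -> dot x g = 1 -> dot x h = 0.
Proof.
move=> Ag Ah.
suff : convex_hull A `<=`
    [set x | 1 <= dot x g /\ (dot x g = 1 -> dot x h = 0)].
  by move=> sub x /sub[].
apply: convex_hull_min => [x Ax|x y t t0 t1 [xg xh] [yg yh]].
  by split; [exact: Ag|exact: Ah].
rewrite /= !dotDl !dotZl; split; first by nra.
move=> xyg; have xg1 : dot x g = 1 by nra.
have yg1 : dot y g = 1 by nra.
by rewrite xh// yh// !mulr0 addr0.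
Qed.

Lemma dot_span_eq0 d (v : d.-tuple 'rV[R]_k) (h : 'cV[R]_k) x :
  (forall i, dot (tnth v i) h = 0) -> x \in <<v>>%VS -> dot x h = 0.
Proof.
move=> vh /coord_span ->; rewrite /dot mulmx_suml summxE big1// => i _.
by rewrite -/(dot _ _) dotZl -tnth_nth vh mulr0.
Qed.

Lemma full_of_delta (U : {vspace 'rV[R]_k}) :
  (forall j, delta_mx 0 j \in U) -> U = fullv.
Proof.
move=> dU; apply/eqP; rewrite eqEsubv subvf; apply/subvP => x _.
rewrite [x]row_sum_delta; apply: memv_suml => j _.
exact: memvZ.
Qed.

Lemma dot_all_eq0 (h : 'cV[R]_k) : (forall x, dot x h = 0) -> h = 0.
Proof.
by move=> h0; apply/colP => i; rewrite -dot_delta_l h0 mxE.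
Qed.

(** A vector off the hyperplane completes [v] to a basis, and [h - c *: g] vanishes on this basis
    for a suitable [c]. *)
Lemma hyperplane_unique d (v : d.-tuple 'rV[R]_k) (g h : 'cV[R]_k) :
  free v -> d.+1 = k -> g != 0 -> (forall i, dot (tnth v i) g = 0) ->
  (forall i, dot (tnth v i) h = 0) -> exists c, h = c *: g.
Proof.
move=> fv dk g0 vg vh.
have [u ug] : exists u, dot u g != 0.
  apply: contrapT => /forallNP no_u; move/eqP: g0; apply.
  by apply: dot_all_eq0 => x; apply/eqP/negPn/negP/no_u.
exists (dot u h / dot u g); apply/eqP; rewrite -subr_eq0; apply/eqP.
have dotZr x c : dot x (- (c *: g)) = - (c * dot x g).
  by rewrite /dot mulmxN -scalemxAr !mxE.
have fuv : free [tuple of u :: v].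
  rewrite free_cons fv andbT; apply/negP => /(dot_span_eq0 vg)/eqP.
  by rewrite (negPf ug).
have full : <<[tuple of u :: v]>>%VS = fullv.
  apply/eqP; rewrite eqEdim subvf dimvf/= (eqP fuv) /= size_tuple dk.
  by rewrite /dim/= mul1n.
apply: dot_all_eq0 => x.
apply: (@dot_span_eq0 d.+1 [tuple of u :: v]); last by rewrite full memvf.
move=> i; case: (unliftP ord0 i) => [l ->|->].
  by rewrite tnthS dotDr dotZr vg vh mulr0 oppr0 addr0.
by rewrite tnth0 dotDr dotZr divfK// subrr.
Qed.

End ConvexHull.

(** * From facets to facet normals *)

Section Facets.
Variables (R : realType) (k : nat) (f : 'rV[R]_2) (M : 'M[R]_(k, 2)).
Variable q : 'I_k -> R.
Hypothesis q_gt0 : forall j, 0 < q j.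
Hypothesis q_int : forall j, q j *: row j M \is a mxOver (Num.int : {pred R}).
Local Notation A := [set s | feasible f M s].
Local Notation P := (convex_hull A).

Lemma feasible_translate s j (n : nat) : feasible f M s ->
  feasible f M (s + (n%:R * q j) *: delta_mx 0 j).
Proof.
move=> [s0 sM]; split.
  by move=> l; rewrite !mxE addr_ge0// !mulr_ge0// ltW.
rewrite mulmxDl -scalemxAl -rowE addrA -scalerA; apply/mxOverP => a b.
rewrite mxE rpredD//; first exact/mxOverP.
rewrite mxE rpredM ?rpred_nat//; exact/mxOverP.
Qed.

Lemma hull_directions_full (U : {vspace 'rV[R]_k}) y s : feasible f M s ->
  (forall x, P x -> x - y \in U) -> U = fullv.
Proof.
move=> sf PU; apply: full_of_delta => j.
have sU := PU s (sub_convex_hull sf).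
have tU := PU _ (sub_convex_hull (feasible_translate j 1 sf)).
have -> : delta_mx 0 j = (q j)^-1 *:
    ((s + (1%:R * q j) *: delta_mx 0 j - y) - (s - y)) :> 'rV[R]_k.
  have qj := lt0r_neq0 (q_gt0 j).
  by apply/rowP => l; rewrite !mxE; field.
by rewrite memvZ// memvB.
Qed.

(** The hull lies in the orthant and recedes along every axis, so a facet inequality [x a <= b] has
    [a <= 0] and [b <= 0]. If [b = 0], the facet lies in a hyperplane [x_j = 0], which its dimension
    [k - 1] identifies with the original one; if [b < 0], division by [b] gives the normal. *)
Lemma facet_cases F : is_facet P F ->
  (exists j, F = P `&` [set x | x 0 j = 0]) \/
  (exists g, facet_normal f M g /\ F = P `&` [set x | dot x g = 1]).
Proof.
move=> [[a [b [Pab FE]]] [d [[x0 [v [Fx0 Fv freev Fspan]]]]]].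
move=> [y0 [w [Py0 Pw freew Pspan]]].
have P0 x : P x -> forall j, 0 <= x 0 j.
  by move: x; apply: convex_hull_ge0 => x [].
have [s0 s0f] : exists s, feasible f M s.
  apply: contrapT => /forallNP no_s.
  have : convex_hull A `<=` set0.
    by apply: convex_hull_min => // s /no_s.
  by move/(_ _ Py0).
have dk : d.+1 = k.
  have /(congr1 (fun U : {vspace 'rV[R]_k} => \dim U)) :=
    hull_directions_full s0f Pspan.
  by rewrite (eqP freew) size_tuple dimvf /dim/= mul1n.
have vdot h c : (forall x, F x -> dot x h = c) ->
    forall i, dot (tnth v i) h = 0.
  move=> Fh i; have := Fh _ (Fv i); rewrite dotDl (Fh _ Fx0).
  by move=> hc; lra.
have Fa x : F x -> dot x a = b by rewrite FE => -[].
have FP x : F x -> P x by rewrite FE => -[].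
(* A zero [a] would make the facet the whole hull, which has dimension [k]. *)
have a0 : a != 0.
  apply/eqP => a0.
  have b0 : b = 0 by rewrite -(Fa _ Fx0) a0 /dot mulmx0 mxE.
  have PF x : P x -> F x.
    by move=> Px; rewrite FE; split=> //=; rewrite a0 b0 mulmx0 mxE.
  have /(congr1 (fun U : {vspace 'rV[R]_k} => \dim U)) :=
    hull_directions_full s0f (fun x Px => Fspan x (PF x Px)).
  rewrite (eqP freev) size_tuple dimvf /dim/= mul1n; lia.
(* Otherwise a long translation along axis [j] would violate the inequality. *)
have ale0 j : a j 0 <= 0.
  rewrite leNgt; apply/negP => aj.
  have qa : 0 < q j * a j 0 by rewrite mulr_gt0.
  pose n := Num.bound ((b - dot s0 a) / (q j * a j 0)).
  have s0b : dot s0 a <= b by apply: Pab; exact: sub_convex_hull.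
  have : (b - dot s0 a) / (q j * a j 0) < n%:R.
    by apply: archi_boundP; rewrite divr_ge0 ?(ltW qa)// subr_ge0.
  rewrite ltr_pdivrMr// => nb.
  have := Pab _ (sub_convex_hull (feasible_translate j n s0f)).
  rewrite -/(dot _ _) dotDl dotZl dot_delta_l; lra.
have xa_le0 (x : 'rV[R]_k) l : P x -> x 0 l * a l 0 <= 0.
  by move=> /P0 x0_; rewrite mulr_ge0_le0.
have [b0|b0] := eqVneq b 0.
  have /cV0Pn[j aj] := a0; left; exists j.
  have Fj x : F x -> dot x (delta_mx j 0) = 0.
    move=> Fx; rewrite dot_delta_r; have := Fa _ Fx.
    rewrite b0 => /eqP; rewrite -oppr_eq0 dotE -sumrN => /eqP/psumr_eq0P.
    move=> /(_ _ j isT)/eqP; rewrite oppr_eq0 mulf_eq0 (negPf aj) orbF.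
    move=> /(_ _)/eqP.
    by apply=> l _; rewrite oppr_ge0; apply: xa_le0; exact: FP.
  have [c cE] := hyperplane_unique freev dk a0 (vdot _ _ Fa) (vdot _ _ Fj).
  have c0 : c != 0.
    apply/eqP => c0; have /colP/(_ j) := cE; rewrite c0 scale0r !mxE !eqxx.
    by move/eqP; rewrite oner_eq0.
  have xj (x : 'rV[R]_k) : x 0 j = c * dot x a.
    by rewrite -dot_delta_r cE /dot -scalemxAr mxE.
  rewrite FE; apply/seteqP; split=> x [Px /= xab]; split=> //=.
    by rewrite xj [dot x a]xab b0 mulr0.
  by apply: (mulfI c0); rewrite -[X in c * X]/(dot x a) -xj xab b0 mulr0.
have b_lt0 : b < 0.
  rewrite lt_def eq_sym b0/= -(Fa _ Fx0) dotE -oppr_ge0 -sumrN.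
  rewrite sumr_ge0// => l _.
  by rewrite oppr_ge0; apply: xa_le0; exact: FP.
have dotg x : dot x (b^-1 *: a) = b^-1 * dot x a.
  by rewrite /dot -scalemxAr mxE.
right; exists (b^-1 *: a).
have FE' : F = P `&` [set x | dot x (b^-1 *: a) = 1].
  rewrite FE; apply/seteqP; split=> x [Px /= xab]; split=> //=.
    by rewrite dotg [dot x a]xab mulVf.
  rewrite -[LHS]/(dot x a); apply: (mulfI (_ : b^-1 != 0)).
    by rewrite invr_eq0.
  by rewrite -dotg xab mulVf.
have valid s : feasible f M s -> 1 <= dot s (b^-1 *: a).
  move=> sf; have sab : dot s a <= b by apply: Pab; exact: sub_convex_hull.
  by rewrite dotg mulrC ler_ndivlMr ?mul1r.
split=> //; split=> // [j|h hT].
  by rewrite mxE mulr_le0// invr_le0 ltW.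
have Fh x : F x -> dot x h = 0.
  rewrite FE' => -[Px xg]; move: Px xg.
  by apply: convex_hull_dot_eq => // s sf sg; apply: hT.
(* Here [h = c *: a]; at [x0] the values of [h] and [a] are 0 and [b != 0], so [c = 0]. *)
have [c cE] := hyperplane_unique freev dk a0 (vdot _ _ Fa) (vdot _ _ Fh).
have : dot x0 h = c * b by rewrite cE /dot -scalemxAr mxE -/(dot _ _) Fa.
rewrite Fh// => /esym/eqP; rewrite mulf_eq0 (negPf b0) orbF => /eqP c0.
by rewrite cE c0 scale0r.
Qed.

End Facets.

(** * Counting the facets by their codes *)

Lemma mixed_integer_setE (R : realType) (k : nat) (f : 'rV[rat]_2)
    (r : 'I_k -> 'rV[rat]_2) :
  mixed_integer_set R f r =
  [set s | feasible (map_mx ratr f) (ray_matrix R r) s].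
Proof.
rewrite /mixed_integer_set /feasible; apply/seteqP; split=> s [s0 sM];
  split=> //; move: sM; rewrite mulmx_sum_row; congr (is_true (_ + _ \is a _));
  by apply: eq_bigr => j _; rewrite rowK.
Qed.

Definition facet_code (k L : nat) : finType := ('I_k + normal_code k L)%type.

Lemma card_facets_code (R : realType) (k : nat) (f : 'rV[rat]_2)
    (r : 'I_k -> 'rV[rat]_2) :
  (facets (convex_hull (mixed_integer_set R f r)) #<=
     `I_(#|{: facet_code k (8 * data_size f r).+1}|)%N)%card.
Proof.
rewrite mixed_integer_setE; set P := convex_hull _.
pose fR : 'rV[R]_2 := map_mx ratr f; pose M := ray_matrix R r.
pose L := (8 * data_size f r).+1.
pose rel (F : set 'rV[R]_k) (m : facet_code k L) := match m with
  | inl j => F = P `&` [set x | x 0 j = 0]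
  | inr m => exists g, [/\ facet_normal fR M g,
      F = P `&` [set x | dot x g = 1] & encodes fR M (grid f r) g m]
  end.
have rel_inj F F' m : rel F m -> rel F' m -> F = F'.
  case: m => [j -> -> //|m [g [ng -> gm]] [g' [ng' -> g'm]]].
  suff -> : g = g' by [].
  by apply: (encodes_inj (@grid_gt0 R k f r) (@grid_nat R k f r)
    (@grid_bits R k f r) ng ng' gm g'm).
have relP F : facets P F -> exists m, rel F m.
  move=> /(facet_cases (q := fun j => (denom (r j))%:~R)).
  move=> [||[j ->]|[g [ng ->]]].
  - by move=> j; rewrite ltr0z denom_gt0.
  - exact: denom_row.
  - by exists (inl j).
  - have [m gm] := encodes_exists (grid f r) L ng.
    by exists (inr m), g.
(* Each facet gets the rank of one of its codes; 0 is a dummy value for all other sets. *)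
have /choice[c cP] : forall F, exists a : nat, facets P F -> exists m,
    rel F m /\ a = enum_rank m.
  move=> F; have [FP|FP] := pselect (facets P F); last by exists 0%N.
  by have [m Fm] := relP F FP; exists (enum_rank m) => _; exists m.
have c_inj : {in facets P &, injective c}.
  move=> F F' /[!inE] /cP[m [Fm ->]] /cP[m' [F'm' ->]] /val_inj/enum_rank_inj.
  by move=> mm'; apply: rel_inj Fm _; rewrite mm'.
rewrite -(card_le_eql (inj_card_eq c_inj)); apply: subset_card_le.
by move=> _ [F /cP[m [_ ->]] <-] /=.
Qed.

Lemma code_count_poly (a b c e : nat) : exists q : {poly nat},
  forall k s, (k <= s)%N ->
    (k + k.+1 ^ a * b ^ c * (((8 * s).+2 * (8 * s).+2).+1 ^ e) <= q.[s])%N.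
Proof.
(* A box coordinate takes [(8 * s).+2] values, one more than the bit bound [(8 * s).+1]. *)
have [L LE] : exists L : {poly nat}, forall s, L.[s] = (8 * s).+2.
  exists (8%N%:P * 'X + 2%N%:P) => s.
  by rewrite hornerD hornerCM hornerX hornerC -[RHS]addn2.
exists ('X + ('X + 1) ^+ a * (b ^ c)%N%:P * (L * L + 1) ^+ e) => k s ks.
rewrite !(hornerD, hornerM, horner_exp, hornerX, hornerC) LE.
rewrite -!natrXE; apply: leq_add => //; apply: leq_mul; last first.
  by rewrite -[X in (X ^ _ <= _)%N]addn1.
apply: leq_mul => //; rewrite -[X in (X ^ _ <= _)%N]addn1.
by case: a => // a; rewrite leq_exp2r// leq_add2r.
Qed.

Theorem theorem1p4 (R : realType) :
  exists q : {poly nat},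
    forall (k : nat) (f : 'rV[rat]_2) (r : 'I_k -> 'rV[rat]_2),
      (facets (convex_hull (mixed_integer_set R f r))
         #<= `I_(q.[data_size f r]))%card.
Proof.
have [q qP] := code_count_poly 36 2 36 (36 * 36).
exists q => k f r; apply: (card_le_trans (card_facets_code R f r)).
rewrite card_le_II; apply: leq_trans (qP _ _ (dimension_le_size f r)).
by rewrite card_sum card_ord card_normal_code.
Qed.
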